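(* Let $N=\{1,\dots,n\}$ ($n\ge 1$) be a set of agents and $M$ a finite set of $m$ indivisible goods. Suppose every agent $i\in N$ has a normalized, monotone valuation $v_i:2^M\to\mathbb{R}_{\ge 0}$ that is both submodular and leveled. Then there exists a complete allocation $A=(A_1,\dots,A_n)\in\Pi_n(M)$ that is $2/3$-MMS, i.e. $v_i(A_i)\ge \tfrac{2}{3}\,\mu_i^n(M)$ for every $i\in N$.
   Context: A valuation $v:2^M\to\mathbb{R}_{\ge0}$ is normalized if $v(\emptyset)=0$, monotone if $v(S)\le v(T)$ whenever $S\subseteq T$, leveled if $v(S)>v(T)$ for all $S,T\subseteq M$ with $|S|>|T|$, and submodular if $v(S)+v(T)\ge v(S\cup T)+v(S\cap T)$ for all $S,T\subseteq M$. $\Pi_n(M)$ is the set of all tuples $(A_1,\dots,A_n)$ of pairwise disjoint (possibly empty) subsets of $M$ whose union is $M$; its elements are the (complete) allocations, $A_i$ being the bundle of agent $i$. The maximin share of agent $i$ is $\mu_i^n(M)=\max_{A\in\Pi_n(M)}\min_{k\in\{1,\dots,n\}} v_i(A_k)$. *)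

(* Defs.v *)
From HB Require Import structures.
From mathcomp Require Import all_boot all_order all_algebra.
From mathcomp Require Import reals.

Set Implicit Arguments.
Unset Strict Implicit.
Unset Printing Implicit Defensive.

Import Order.TTheory GRing.Theory Num.Theory.
Local Open Scope ring_scope.

(* The set of goods is the finite type M itself, so bundles are elements of
   {set M} and the grand bundle is [set: M]. *)

Definition nonnegative (R : realType) (M : finType) (v : {set M} -> R) : Prop :=
  forall S : {set M}, 0 <= v S.

Definition normalized (R : realType) (M : finType) (v : {set M} -> R) : Prop :=
  v set0 = 0.

Definition monotone (R : realType) (M : finType) (v : {set M} -> R) : Prop :=
  forall S T : {set M}, S \subset T -> v S <= v T.

Definition leveled (R : realType) (M : finType) (v : {set M} -> R) : Prop :=
  forall S T : {set M}, (#|T| < #|S|)%N -> v T < v S.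

Definition submodular (R : realType) (M : finType) (v : {set M} -> R) : Prop :=
  forall S T : {set M}, v (S :|: T) + v (S :&: T) <= v S + v T.

(* Bundles may be empty, so an allocation is not a [partition] in the sense of
   finset. *)
Definition allocations (n : nat) (M : finType) : {set {ffun 'I_n -> {set M}}} :=
  [set A : {ffun 'I_n -> {set M}} |
     [forall i, forall j, (i != j) ==> [disjoint A i & A j]] &&
     (\bigcup_(i < n) A i == [set: M])].

(* The default v [set: M] does not affect the minimum when v is monotone and
   0 < n; see [min_bundle_le] and [min_bundle_attained]. *)
Definition min_bundle (R : realType) (n : nat) (M : finType)
    (v : {set M} -> R) (A : {ffun 'I_n -> {set M}}) : R :=
  \big[Num.min/v [set: M]]_(k < n) v (A k).

(* The default 0 does not affect the maximum when v is nonnegative; see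
   [mms_ge] and [mms_attained]. *)
Definition mms (R : realType) (n : nat) (M : finType) (v : {set M} -> R) : R :=
  \big[Num.max/0]_(A in allocations n M) min_bundle v A.

Lemma min_bundle_le (R : realType) (n : nat) (M : finType)
    (v : {set M} -> R) (A : {ffun 'I_n -> {set M}}) (k : 'I_n) :
  min_bundle v A <= v (A k).
Proof. exact: bigmin_le_cond. Qed.

Lemma min_bundle_attained (R : realType) (n : nat) (M : finType)
    (v : {set M} -> R) (A : {ffun 'I_n -> {set M}}) :
  (0 < n)%N -> monotone v -> exists k : 'I_n, min_bundle v A = v (A k).
Proof.
move=> n_gt0 vmono; rewrite /min_bundle.
have [k _ ->] := @eq_bigmin _ R _ (v [set: M]) (Ordinal n_gt0) xpredT
  (fun k => v (A k)) isT (fun k _ => vmono _ _ (subsetT _)).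
by exists k.
Qed.

Lemma mms_ge (R : realType) (n : nat) (M : finType) (v : {set M} -> R)
    (A : {ffun 'I_n -> {set M}}) :
  A \in allocations n M -> min_bundle v A <= mms n v.
Proof. by move=> hA; apply: (le_bigmax_cond _ _ hA). Qed.

Lemma mms_attained (R : realType) (n : nat) (M : finType) (v : {set M} -> R) :
  (0 < n)%N -> nonnegative v -> monotone v ->
  exists2 A, A \in allocations n M & mms n v = min_bundle v A.
Proof.
move=> n_gt0 v_ge0 vmono; rewrite /mms; pose i0 := Ordinal n_gt0.
pose A0 := [ffun i : 'I_n => if i == i0 then [set: M] else set0].
have hA0 : A0 \in allocations n M.
  rewrite inE; apply/andP; split.
    apply/forallP => i; apply/forallP => j; apply/implyP => ij; rewrite !ffunE.
    have [ei|_] := eqVneq i i0; last by rewrite disjoints_subset sub0set.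
    by rewrite -ei eq_sym (negPf ij) disjoint_sym disjoints_subset sub0set.
  rewrite eqEsubset subsetT /=; apply: (bigcup_max i0) => //.
  by rewrite ffunE eqxx.
have [A hA ->] := @eq_bigmax _ R _ 0 A0 (mem (allocations n M))
  (fun A => min_bundle v A) hA0
  (fun A _ => let: ex_intro k e := min_bundle_attained A n_gt0 vmono in
    eq_ind_r (fun x => 0 <= x) (v_ge0 (A k)) e).
by exists A.
Qed.

(* Main.v *)
(* Write #|M| = q n + r with r < n. By leveledness any bundle of at least q + 1
   goods is worth the maximin share mu, so r agents may receive arbitrary q + 1
   goods, and the problem is to serve the other n - r agents with q goods each.
   - If q >= 3, submodularity and leveledness make any q goods worth 2/3 mu.
   - If q = 1, each agent has at least n - r goods worth mu, so they can pick in
     turn.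
   - If q = 2, call a pair bad for an agent if it is worth less than 2/3 mu. If
     {a, x} and {a, y} were both bad, then v{a,x} + v{a,y} >= v{a,x,y} + v{a}
     and v{a,x,y} >= mu would give v{a} < mu / 3. Unless every pair is good,
     a balanced maximin partition yields 2(n - r) goods worth at least mu / 3,
     hence with at most one bad partner each, and the agents can again pick in
     turn. Only when r = 0 may the last agent be stuck with a bad pair; then
     every good has at most one bad partner, and the last two agents can split
     the last four goods. *)

Require Import Defs.
From mathcomp Require Import all_boot all_order all_algebra.
From mathcomp Require Import reals.
From mathcomp Require Import zify lra.

Set Implicit Arguments.
Unset Strict Implicit.
Unset Printing Implicit Defensive.

Import Order.TTheory GRing.Theory Num.Theory.
Local Open Scope ring_scope.

(** * Greedy choice of disjoint bundles, and counting over an allocation *)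

Lemma exists_subset_card (T : finType) (A : {set T}) (k : nat) :
  (k <= #|A|)%N -> exists2 B : {set T}, B \subset A & #|B| = k.
Proof.
case/card_geqP => s [us <- sA]; exists [set x in s].
  by apply/subsetP => x; rewrite inE => /sA.
by rewrite cardsE; apply/card_uniqP.
Qed.

(** [U] is the union of the first [k] bundles: the invariant [P] sees only which goods are taken,
    not who holds them. *)
Lemma greedy_bundles (T : finType) (n : nat) (P ok : nat -> {set T} -> Prop) :
  P 0%N set0 ->
  (forall k U, (k < n)%N -> P k U ->
     exists B : {set T}, [/\ [disjoint U & B], ok k B & P k.+1 (U :|: B)]) ->
  exists B : nat -> {set T},
    (forall i j, (i < n)%N -> (j < n)%N -> i != j -> [disjoint B i & B j]) /\
    (forall i, (i < n)%N -> ok i (B i)).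
Proof.
move=> P0 step.
suff /(_ n (leqnn n)) [B [? ? _]] : forall k, (k <= n)%N ->
    exists B : nat -> {set T},
    [/\ forall i j, (i < k)%N -> (j < k)%N -> i != j -> [disjoint B i & B j],
        forall i, (i < k)%N -> ok i (B i) & P k (\bigcup_(i < k) B i)] by exists B.
elim=> [|k IH] kn; first by exists (fun=> set0); split=> //; rewrite big_ord0.
have [B [Bdis Bok BP]] := IH (ltnW kn).
have [C [UC Cok CP]] := step _ _ kn BP.
have BC i : (i < k)%N -> [disjoint B i & C].
  move=> ik; apply: disjointWl UC; exact: (bigcup_sup (Ordinal ik)).
exists (fun i => if (i < k)%N then B i else C); split.
- move=> i j; rewrite !ltnS => ik jk ij.
  case: ltnP => ik'; case: ltnP => jk'; [exact: Bdis|exact: BC| |lia].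
  by rewrite disjoint_sym BC.
- move=> i; rewrite ltnS; case: ltnP => [/Bok //|ki ik].
  by have -> : i = k by lia.
- rewrite big_ord_recr /= ltnn.
  by under eq_bigr => i _ do rewrite ltn_ord.
Qed.

Lemma card_allocation (n : nat) (M : finType) (A : {ffun 'I_n -> {set M}})
    (H : {set M}) :
  A \in allocations n M -> #|H| = (\sum_(k < n) #|A k :&: H|)%N.
Proof.
rewrite inE => /andP[/forallP Adis /eqP Acov].
have -> : H = \bigcup_(k < n) (A k :&: H) by rewrite -big_distrl /= Acov setTI.
rewrite -sum1_card partition_disjoint_bigcup => [|i j ij]; last first.
  have /forallP/(_ j)/implyP/(_ ij) := Adis i.
  apply: disjointW; exact: subsetIl.
by apply: eq_bigr => k _; rewrite sum1_card -big_distrl /= Acov setTI.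
Qed.

(** * One valuation: bundles worth two thirds of the maximin share *)

Section Valuation.

Variables (R : realType) (n : nat) (M : finType) (v : {set M} -> R).
Hypotheses (n_gt0 : (0 < n)%N) (v_ge0 : nonnegative v).
Hypotheses (v_mono : monotone v) (v_submod : submodular v) (v_lev : leveled v).

Local Notation mu := (mms n v).
Local Notation q := (#|M| %/ n)%N.
Local Notation r := (#|M| %% n)%N.

Definition acceptable (B : {set M}) : bool := 2 / 3 * mms n v <= v B.

Lemma mms_ge0 : 0 <= mu.
Proof.
have [A _ ->] := mms_attained n_gt0 v_ge0 v_mono.
by have [k ->] := min_bundle_attained A n_gt0 v_mono.
Qed.

Lemma mms_acceptable (B : {set M}) : mu <= v B -> acceptable B.
Proof. by have := mms_ge0; rewrite /acceptable; lra. Qed.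

(** Otherwise the bundles would hold at least [n (q + 1) > #|M|] goods. *)
Lemma exists_small_bundle (A : {ffun 'I_n -> {set M}}) :
  A \in allocations n M -> exists k, (#|A k| <= q)%N.
Proof.
move=> hA; apply/existsP; apply: contraT => /existsPn large.
have := card_allocation [set: M] hA; rewrite cardsT.
under eq_bigr => k _ do rewrite setIT.
have : (\sum_(k < n) q.+1 <= \sum_(k < n) #|A k|)%N.
  by apply: leq_sum => k _; rewrite ltnNge large.
rewrite sum_nat_const card_ord mulnC => le_sum eq_sum.
by have := leq_ltn_trans (leq_trans le_sum _) (ltn_ceil #|M| n_gt0);
  rewrite -eq_sum ltnn => /(_ (leqnn _)).
Qed.

Lemma mms_le_large (B : {set M}) : (q < #|B|)%N -> mu <= v B.
Proof.
move=> qB; have [A hA ->] := mms_attained n_gt0 v_ge0 v_mono.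
have [k Ak] := exists_small_bundle hA.
exact: le_trans (min_bundle_le v A k) (ltW (v_lev (leq_ltn_trans Ak qB))).
Qed.

Lemma mms_le_full : mu <= v [set: M].
Proof.
have [A hA ->] := mms_attained n_gt0 v_ge0 v_mono.
exact: le_trans (min_bundle_le v A (Ordinal n_gt0)) (v_mono (subsetT _)).
Qed.

(** If some bundle of a maximin allocation has fewer than [q] goods, leveledness ranks every set of
    [q] or more goods above it; otherwise that allocation is balanced. *)
Lemma mms_le_or_balanced :
  (forall B : {set M}, (q <= #|B|)%N -> mu <= v B) \/
  (exists2 A, A \in allocations n M &
     forall k, (q <= #|A k|)%N /\ mu <= v (A k)).
Proof.
have [A hA muE] := mms_attained n_gt0 v_ge0 v_mono.
have [/forallP big|] := boolP [forall k, (q <= #|A k|)%N].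
  by right; exists A => // k; split=> //; rewrite muE min_bundle_le.
rewrite negb_forall => /existsP[k]; rewrite -ltnNge => Ak.
left=> B qB; rewrite muE.
exact: le_trans (min_bundle_le v A k) (ltW (v_lev (leq_trans Ak qB))).
Qed.

(* Submodularity gives v(T - x) + v(T - y) + v(T - z) >= 2 v(T), and by
   leveledness each of the three sets is worth less than B. *)
Lemma acceptable_ge3 (B : {set M}) : (2 < q)%N -> #|B| = q -> acceptable B.
Proof.
move=> q3 Bq; have [A hA muE] := mms_attained n_gt0 v_ge0 v_mono.
have [k] := exists_small_bundle hA; have muA := min_bundle_le v A k.
rewrite -muE in muA; move: (A k) muA => T muT Tq.
have [TB|] := ltnP #|T| q.
  by apply: mms_acceptable; apply: le_trans muT (ltW (v_lev _)); rewrite Bq.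
move=> qT; have Tq' : #|T| = q by lia.
have /card_gt2P[x [y [z [[xT yT zT] [xy yz zx]]]]] : (2 < #|T|)%N by lia.
have lt t : t \in T -> v (T :\ t) < v B.
  by move=> tT; apply: v_lev; rewrite (cardsD1 t T) tT in Tq'; lia.
have := v_submod (T :\ x) (T :\ y).
have := v_submod ((T :\ x) :&: (T :\ y)) (T :\ z).
have -> : (T :\ x) :|: (T :\ y) = T.
  apply/setP => t; rewrite !inE; case: (t \in T) => //; rewrite ?andbT ?andbF //.
  by case: eqVneq => // ->.
have -> : ((T :\ x) :&: (T :\ y)) :|: (T :\ z) = T.
  apply/setP => t; rewrite !inE; case: (t \in T) => //; rewrite ?andbT ?andbF //.
  case: (eqVneq t z) => [->|]; last by rewrite orbT.
  by rewrite zx eq_sym yz.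
have := v_ge0 (((T :\ x) :&: (T :\ y)) :&: (T :\ z)).
have := lt _ xT; have := lt _ yT; have := lt _ zT; rewrite /acceptable; lra.
Qed.

(** In a balanced maximin allocation each bundle is an acceptable singleton or has at least two
    goods, so [#|A k :&: H| + #|A k| >= 2]. Summing gives [#|H| + #|M| >= 2 n], where
    [#|M| = n + r]. *)
Lemma card_acceptable_goods :
  q = 1%N -> (n - r <= #|[set g | acceptable [set g]]|)%N.
Proof.
move=> q1; set H := [set g | _]; have mE := divn_eq #|M| n.
have [all_ok|[A hA Aok]] := mms_le_or_balanced.
  have -> : H = setT.
    by apply/setP => g; rewrite !inE mms_acceptable ?all_ok ?cards1 ?q1.
  by rewrite cardsT; lia.
have : (\sum_(k < n) 2 <= \sum_(k < n) (#|A k :&: H| + #|A k :&: setT|))%N.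
  apply: leq_sum => k _; rewrite setIT; have [qk muk] := Aok k.
  have [|Ak] := ltnP 1 #|A k|; first lia.
  have /cards1P[g Ag] : #|A k| == 1%N by apply/eqP; lia.
  have gH : g \in H by rewrite inE -Ag mms_acceptable.
  by rewrite Ag (setIidPl _) ?sub1set // cards1.
rewrite big_split /= -!(card_allocation _ hA) cardsT sum_nat_const card_ord.
by lia.
Qed.

Definition one_bad_partner (a : M) : bool :=
  [forall x, forall y, [&& x != a, y != a & x != y] ==>
     acceptable [set a; x] || acceptable [set a; y]].

Lemma one_bad_partnerP (a x y : M) :
  one_bad_partner a -> x != a -> y != a -> x != y ->
  acceptable [set a; x] \/ acceptable [set a; y].
Proof.
by move=> /forallP/(_ x)/forallP/(_ y)/implyP h xa ya xy; apply/orP/h/and3P.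
Qed.

Lemma one_bad_partner_of_third (a : M) :
  q = 2%N -> mu <= 3 * v [set a] -> one_bad_partner a.
Proof.
move=> q2 mua; apply/forallP => x; apply/forallP => y; apply/implyP.
case/and3P => xa ya xy; apply: contraT; rewrite negb_or => /andP[].
rewrite /acceptable -!ltNge => lx ly.
have := v_submod [set a; x] [set a; y].
have -> : [set a; x] :&: [set a; y] = [set a].
  apply/setP => t; rewrite !inE; case: (eqVneq t a) => //= _.
  by apply/negP => /andP[/eqP-> ]; rewrite (negPf xy).
have muU : mu <= v ([set a; x] :|: [set a; y]).
  apply: mms_le_large; rewrite q2; apply/card_gt2P; exists a, x, y.
  by rewrite !inE !eqxx !orbT; split; split=> //; rewrite eq_sym.
lra.
Qed.

(* In a balanced maximin partition each two-element bundle has both its goods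
   in H, unless some single good is already worth 2/3 of the maximin share;
   hence #|A k :&: H| + 2 #|A k| >= 6 for every k. *)
Lemma card_one_bad_partner :
  q = 2%N -> (2 * (n - r) <= #|[set a | one_bad_partner a]|)%N.
Proof.
move=> q2; set H := [set a | _]; have mE := divn_eq #|M| n.
have [all_ok|no_all] :=
    boolP [forall x, forall y, (x != y) ==> acceptable [set x; y]].
  have -> : H = setT.
    apply/setP => a; rewrite !inE; apply/forallP => x; apply/forallP => y.
    apply/implyP => /and3P[xa _ _].
    have /forallP/(_ a)/forallP/(_ x)/implyP -> // := all_ok.
    by rewrite eq_sym.
  by rewrite cardsT; lia.
have cheap g : v [set g] < 2 / 3 * mu.
  rewrite ltNge; apply: contra no_all => vg.
  apply/forallP => x; apply/forallP => y; apply/implyP => xy.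
  by apply: le_trans vg (ltW (v_lev _)); rewrite cards1 cards2 xy.
have [all_ok|[A hA Aok]] := mms_le_or_balanced.
  case/negP: no_all; apply/forallP => x; apply/forallP => y; apply/implyP => xy.
  by apply: mms_acceptable; apply: all_ok; rewrite cards2 xy q2.
have : (\sum_(k < n) 6 <= \sum_(k < n) (#|A k :&: H| + 2 * #|A k :&: setT|))%N.
  apply: leq_sum => k _; rewrite setIT; have [qk muk] := Aok k.
  have [|Ak] := ltnP 2 #|A k|; first lia.
  have /cards2P[x [y [xy Axy]]] : #|A k| == 2%N by apply/eqP; lia.
  (* By submodularity the two goods are together worth at least [mu]; as each is below [2/3 mu],
     both exceed [mu / 3]. *)
  have := v_submod [set x] [set y]; rewrite -Axy => sub.
  have := v_ge0 ([set x] :&: [set y]); have := cheap x; have := cheap y.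
  move=> cx cy pos.
  have xH : x \in H by rewrite inE one_bad_partner_of_third //; lra.
  have yH : y \in H by rewrite inE one_bad_partner_of_third //; lra.
  by rewrite Axy (setIidPl _) ?cards2 ?xy // subUset !sub1set xH.
rewrite big_split /= -big_distrr /= -!(card_allocation _ hA).
by rewrite cardsT sum_nat_const card_ord; lia.
Qed.

(** Serves the next of the [n - r] agents who get [q] goods: at most [n - r - 1] of them came
    before. *)
Lemma exists_acceptable_disjoint (U : {set M}) :
  (q != 2%N) || (0 < r)%N -> (#|U| <= q * (n - r).-1)%N ->
  exists B : {set M}, [/\ [disjoint U & B], #|B| = q & acceptable B].
Proof.
move=> qr Uq; have mE := divn_eq #|M| n; have rn := ltn_pmod #|M| n_gt0.
have cU := cardsC U.
have sub (B : {set M}) : B \subset ~: U -> [disjoint U & B].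
  by rewrite disjoint_sym disjoints_subset.
have [q_small|q_big] := leqP q 2; last first.
  have [|B BU Bq] := @exists_subset_card _ (~: U) q; first nia.
  by exists B; rewrite Bq (acceptable_ge3 q_big Bq) sub.
have outside (H : {set M}) : (#|U| < #|H|)%N -> exists2 g, g \in H & g \in ~: U.
  move=> UH; have /subsetPn[g gH gU] : ~~ (H \subset U).
    by apply/negP => /subset_leq_card; lia.
  by exists g; rewrite // inE.
(* For [q = 0] some maximin bundle is empty, so the empty set is worth [mu]. *)
have [q0|q_gt0] := posnP q.
  exists set0; rewrite cards0 q0 sub ?sub0set; split=> //.
  have [A hA muE] := mms_attained n_gt0 v_ge0 v_mono.
  have [k Ak] := exists_small_bundle hA.
  apply: mms_acceptable; rewrite muE.
  move: Ak; rewrite q0 leqn0 cards_eq0 => /eqP <-.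
  exact: min_bundle_le.
have [q1|q2] := eqVneq q 1%N.
  have [|g] := outside [set g | acceptable [set g]].
    by have := card_acceptable_goods q1; rewrite q1 in Uq; lia.
  rewrite inE => gok gU; exists [set g].
  by rewrite cards1 gok sub ?sub1set.
have {}q2 : q = 2%N by lia.
rewrite q2 /= in qr Uq mE.
have [|a] := outside [set a | one_bad_partner a].
  by have := card_one_bad_partner q2; lia.
rewrite inE => aone aU.
(* At least [3 r + 2] goods lie outside [U]; two partners besides [a] are needed, hence [0 < r]. *)
have /card_gt1P[x [y [xU yU xy]]] : (1 < #|~: U :\ a|)%N.
  by have := cardsD1 a (~: U); rewrite aU; lia.
move: xU yU; rewrite !inE => /andP[xa xU] /andP[ya yU]; rewrite inE in aU.
have [ok|ok] := one_bad_partnerP aone xa ya xy.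
  exists [set a; x]; rewrite ok q2 cards2 eq_sym xa sub //.
  by rewrite subUset !sub1set !inE aU.
exists [set a; y]; rewrite ok q2 cards2 eq_sym ya sub //.
by rewrite subUset !sub1set !inE aU.
Qed.

(** With [r = 0] the bound [2 (n - r)] equals [#|M|]. *)
Lemma all_one_bad_partner : q = 2%N -> r = 0%N -> forall a, one_bad_partner a.
Proof.
move=> q2 r0 a; have mE := divn_eq #|M| n; have := card_one_bad_partner q2.
set H := [set a | _] => cH.
have /eqP HT : H == setT by rewrite eqEcard subsetT cardsT; lia.
have : a \in H by rewrite HT.
by rewrite inE.
Qed.

End Valuation.

(* For a fixed good a, each agent rejects at most one of the three splits
   {a, x} / S - {a, x}: the first because the pairs {a, x} share a, the second
   because the three complementary pairs meet pairwise. *)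
Lemma split_four (R : realType) (n : nat) (M : finType) (v1 v2 : {set M} -> R)
    (S : {set M}) :
  (forall a, one_bad_partner n v1 a) -> (forall a, one_bad_partner n v2 a) ->
  #|S| = 4%N ->
  exists e : {set M},
    [/\ e \subset S, #|e| = 2%N, acceptable n v1 e & acceptable n v2 (S :\: e)].
Proof.
move=> one1 one2 S4.
have /card_geqP[s [us ss sS]] : (4 <= #|S|)%N by rewrite S4.
have SE : S = [set x in s].
  apply/esym/eqP; rewrite eqEcard cardsE (card_uniqP us) ss S4 andbT.
  by apply/subsetP => x; rewrite inE => /sS.
case: s us ss SE {sS} => [|a [|b [|c [|d [|]]]]] // us _ SE.
set goal := exists e, _.
(* One argument covers all three splits, which differ by a reordering of the goods. *)
have split x y z t : perm_eq [:: x; y; z; t] [:: a; b; c; d] ->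
    acceptable n v1 [set x; y] -> acceptable n v2 [set z; t] -> goal.
  move=> p; have := us; rewrite -(perm_uniq p) /= !inE !negb_or; move: p.
  move=> + /and4P[/and3P[xy xz xt] /andP[yz yt] zt _].
  move=> /perm_mem abcd ok1 ok2.
  have {}SE : S = [set x; y; z; t].
    by apply/setP => g; rewrite SE inE -abcd !inE -!orbA.
  exists [set x; y]; split=> //.
  - by apply/subsetP => g; rewrite SE !inE -!orbA => /orP[->|->]; rewrite ?orbT.
  - by rewrite cards2 xy.
  suff -> : S :\: [set x; y] = [set z; t] by [].
  apply/setP => g; rewrite SE !inE.
  have [->|_] := eqVneq g x; first by rewrite (negPf xz) (negPf xt).
  by have [->|_] := eqVneq g y; first by rewrite (negPf yz) (negPf yt).
move: us; rewrite /= !inE !negb_or andbT.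
move=> /and3P[/and3P[ab ac ad] /andP[bc bd] cd].
have Sab := split a b c d (perm_refl _).
have Sac : acceptable n v1 [set a; c] -> acceptable n v2 [set b; d] -> goal.
  by apply: split; rewrite perm_cons (perm_catCA [:: c] [:: b] [:: d]).
have Sad : acceptable n v1 [set a; d] -> acceptable n v2 [set b; c] -> goal.
  by apply: split; rewrite perm_cons (perm_catC [:: d] [:: b; c]).
have one1a x y : a != x -> a != y -> x != y ->
    acceptable n v1 [set a; x] \/ acceptable n v1 [set a; y].
  by move=> *; apply: one_bad_partnerP; rewrite // eq_sym.
have bc_bd : acceptable n v2 [set b; c] \/ acceptable n v2 [set b; d].
  by apply: one_bad_partnerP; rewrite // eq_sym.
have bc_cd : acceptable n v2 [set b; c] \/ acceptable n v2 [set c; d].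
  by rewrite [[set b; c]]setUC; apply: one_bad_partnerP; rewrite // eq_sym.
have bd_cd : acceptable n v2 [set b; d] \/ acceptable n v2 [set c; d].
  by rewrite ![[set _; d]]setUC; apply: one_bad_partnerP.
have := one1a b c ab ac bc; have := one1a b d ab ad bd.
have := one1a c d ac ad cd; tauto.
Qed.

(** * All agents: assembling the allocation *)

Section Agents.

Variables (R : realType) (n : nat) (M : finType) (v : 'I_n -> {set M} -> R).
Hypothesis n_gt0 : (0 < n)%N.
Hypotheses (v_ge0 : forall i, nonnegative (v i)).
Hypotheses (v_mono : forall i, monotone (v i)).
Hypotheses (v_submod : forall i, submodular (v i)).
Hypotheses (v_lev : forall i, leveled (v i)).

Local Notation q := (#|M| %/ n)%N.
Local Notation r := (#|M| %% n)%N.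

(** Ranging over the ordinals equal to [k] allows bundles indexed by [nat]. *)
Let accept (k : nat) (B : {set M}) : Prop :=
  forall i : 'I_n, i = k :> nat -> acceptable n (v i) B.

Lemma accept_ord (i : 'I_n) (B : {set M}) :
  acceptable n (v i) B -> accept i B.
Proof. by move=> ok j /val_inj ->. Qed.

Lemma exists_disjoint_bundles_2n :
  q = 2%N -> r = 0%N ->
  exists B : nat -> {set M},
    (forall i j, (i < n)%N -> (j < n)%N -> i != j -> [disjoint B i & B j]) /\
    (forall i, (i < n)%N -> accept i (B i)).
Proof.
move=> q2 r0; have := divn_eq #|M| n; rewrite q2 r0 => mE.
have one i : forall a, one_bad_partner n (v i) a.
  by apply: all_one_bad_partner.
(* The second clause reserves for the last agent a remainder that this agent accepts. *)
pose P k (U : {set M}) := #|U| = k.*2 /\ (k.+1 = n -> accept k (~: U)).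
apply: (@greedy_bundles _ _ P).
  split; first by rewrite cards0.
  by move=> _ i _; rewrite setC0 mms_acceptable ?mms_le_full.
move=> k U kn [cU okU]; have cC := cardsC U.
have [k1n|k1n] := ltnP k.+1 n; last first.
  have kE : k.+1 = n by lia.
  exists (~: U); split; [by rewrite -setI_eq0 setICr|exact: okU|].
  by split; [rewrite setUCr cardsT; lia|lia].
(* The half left for agent [k.+1] matters only when [k.+2 = n]; then [S] is all that remains. *)
have [|S SU S4] := @exists_subset_card _ (~: U) 4; first lia.
have [e [eS e2 ok1 ok2]] :=
  split_four (one (Ordinal kn)) (one (Ordinal k1n)) S4.
have Ue : [disjoint U & e].
  by rewrite disjoint_sym disjoints_subset (subset_trans eS).
exists e; split=> //; first exact: (@accept_ord (Ordinal kn)).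
split; first by rewrite cardsU disjoint_setI0 // cards0; lia.
move=> k2n; suff -> : ~: (U :|: e) = S :\: e.
  exact: (@accept_ord (Ordinal k1n)).
have -> : S = ~: U by apply/eqP; rewrite eqEcard SU; lia.
by rewrite setCU setDE.
Qed.

Lemma exists_disjoint_bundles :
  (q != 2%N) || (0 < r)%N ->
  exists B : nat -> {set M},
    (forall i j, (i < n)%N -> (j < n)%N -> i != j -> [disjoint B i & B j]) /\
    (forall i, (i < n)%N -> accept i (B i)).
Proof.
move=> qr; have mE := divn_eq #|M| n; have rn := ltn_pmod #|M| n_gt0.
(* The truncated difference counts the agents already given [q + 1] goods; these come last. *)
pose P k (U : {set M}) := (#|U| <= q * k + (k - (n - r)))%N.
apply: (@greedy_bundles _ _ P); first by rewrite /P cards0.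
move=> k U kn; rewrite /P => cU; have cC := cardsC U.
have cardU (B : {set M}) : (#|U :|: B| <= #|U| + #|B|)%N.
  exact: leq_card_setU.
have [k_small|k_big] := ltnP k (n - r).
  have [|B [UB Bq Bok]] := exists_acceptable_disjoint n_gt0
    (v_ge0 (Ordinal kn)) (v_mono _) (v_submod _) (v_lev _) (U := U) qr.
    apply: leq_trans cU _.
    have -> : (k - (n - r) = 0)%N by lia.
    by rewrite addn0 leq_mul2l; apply/orP; right; lia.
  exists B; split=> //; first exact: (@accept_ord (Ordinal kn)).
  by have := cardU B; rewrite Bq mulnS; lia.
(* At least [(q + 1) (n - k)] goods remain. *)
have [|B BU Bq] := @exists_subset_card _ (~: U) q.+1.
  move: mE cU; move: q => q' mE cU; nia.
exists B; split.
- by rewrite disjoint_sym disjoints_subset.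
- by move=> i _; apply: mms_acceptable => //; apply: mms_le_large; rewrite ?Bq.
- by have := cardU B; rewrite Bq mulnS; lia.
Qed.

Lemma exists_acceptable_allocation :
  exists A : {ffun 'I_n -> {set M}},
    A \in allocations n M /\ forall i, acceptable n (v i) (A i).
Proof.
have [B [Bdis Bok]] : exists B : nat -> {set M},
    (forall i j, (i < n)%N -> (j < n)%N -> i != j -> [disjoint B i & B j]) /\
    (forall i, (i < n)%N -> accept i (B i)).
  have [qr|] := boolP ((q != 2%N) || (0 < r)%N).
    exact: exists_disjoint_bundles.
  rewrite negb_or negbK -eqn0Ngt => /andP[/eqP q2 /eqP r0].
  exact: exists_disjoint_bundles_2n.
(* The leftover goods [L] go to agent [i0], which is harmless by monotonicity. *)
pose i0 := Ordinal n_gt0; pose L := ~: \bigcup_(i < n) B i.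
have BL (i : 'I_n) : [disjoint B i & L].
  by rewrite disjoints_subset setCK; exact: (bigcup_sup i).
pose A := [ffun i : 'I_n => if i == i0 then B i :|: L else B i].
have BA (i : 'I_n) : B i \subset A i.
  by rewrite ffunE; case: ifP => // _; exact: subsetUl.
exists A; split; last first.
  move=> i; have := Bok i (ltn_ord i) i erefl; rewrite /acceptable => ok.
  exact: le_trans ok (@v_mono i _ _ (BA i)).
rewrite inE; apply/andP; split.
  apply/forallP => i; apply/forallP => j; apply/implyP => ij.
  have dij : [disjoint B i & B j] by apply: Bdis.
  rewrite !ffunE; case: (eqVneq i i0) => [ei|_]; case: (eqVneq j i0) => [ej|_] //.
  - by rewrite ei ej eqxx in ij.
  - by rewrite -setI_eq0 setIUl setU_eq0 !setI_eq0 dij disjoint_sym BL.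
  - by rewrite -setI_eq0 setIUr setU_eq0 !setI_eq0 dij BL.
rewrite eqEsubset subsetT /=; apply/subsetP => g _.
have [/bigcupP[i _ gi]|gL] := boolP (g \in \bigcup_(i < n) B i).
  by apply/bigcupP; exists i => //; apply: (subsetP (BA i)).
apply/bigcupP; exists i0 => //.
by rewrite ffunE eqxx !inE gL orbT.
Qed.

End Agents.

Theorem theorem1 (R : realType) (n : nat) (M : finType)
    (v : 'I_n -> {set M} -> R)
    (n_gt0 : (1 <= n)%N)
    (v_nonneg : forall i : 'I_n, nonnegative (v i))
    (v_norm : forall i : 'I_n, normalized (v i))
    (v_mono : forall i : 'I_n, monotone (v i))
    (v_submod : forall i : 'I_n, submodular (v i))
    (v_leveled : forall i : 'I_n, leveled (v i)) :
  exists A : {ffun 'I_n -> {set M}},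
    A \in allocations n M /\
    forall i : 'I_n, 2 / 3 * mms n (v i) <= v i (A i).
Proof. exact: exists_acceptable_allocation. Qed.
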